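(* Let $r,s,l,h\ge 0$ be integers and let $a,\ a_1,\dots,a_r,\ b_1,\dots,b_s,\ c,\ c_1,\dots,c_l,\ d_1,\dots,d_h$ be complex parameters not depending on the degree index (arbitrary, subject only to the convention that the expressions below are well defined). Then for every integer $n\ge 0$ the following two identities of polynomials in $x$ hold. (Inversion formula) $$x^n=\frac{[b_s;q]_n}{[a_r;q]_n}\left((-1)^nq^{\frac{n(n-1)}{2}}\right)^{r+1-s}\sum_{m=0}^n {n\brack m}_q\frac{(-1)^mq^{\frac{m(m-1)}{2}}}{(aq^m;q)_m\,(aq^{2m+1};q)_{n-m}}\; {}_{r+2}\phi_{s}\!\left(\begin{matrix}q^{-m},\,aq^m,\,(a_r)\\ (b_s)\end{matrix};q;qx\right).$$ (Connection formula) $$\begin{aligned} {}_{r+2}\phi_{s}\!\left(\begin{matrix}q^{-n},\,aq^n,\,(a_r)\\ (b_s)\end{matrix};q;qx\right)=\sum_{m=0}^n&\;{n\brack m}_q(-1)^{m(s+l-r-h)}\,\frac{(aq^n;q)_m}{(cq^m;q)_m}\,\frac{[a_r;q]_m}{[b_s;q]_m}\,\frac{[d_h;q]_m}{[c_l;q]_m}\; q^{\frac{m(m-1)}{2}(s+l-r-h)}\,q^{m(m-n)}\\ &\times {}_{r+h+2}\phi_{s+l+1}\!\left(\begin{matrix}q^{m-n},\,aq^{m+n},\,(a_rq^m),\,(d_hq^m)\\ cq^{2m+1},\,(b_sq^m),\,(c_lq^m)\end{matrix};q;q^{1+m(s+l-r-h)}\right)\\ &\times {}_{l+2}\phi_{h}\!\left(\begin{matrix}q^{-m},\,cq^m,\,(c_l)\\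 (d_h)\end{matrix};q;qx\right). \end{aligned}$$
   Context: Notation. $q$ is the base, a nonzero complex number. The $q$-shifted factorial is $(x;q)_0=1$ and $(x;q)_n=\prod_{k=0}^{n-1}(1-xq^k)$ for $n\ge 1$. The $q$-binomial coefficient is ${n\brack k}_q=\dfrac{(q;q)_n}{(q;q)_k(q;q)_{n-k}}$. The symbol $(a_r)$ abbreviates the list of $r$ parameters $a_1,\dots,a_r$, and $(a_rq^m)$ abbreviates the list $a_1q^m,\dots,a_rq^m$; similarly for $(b_s)$, $(c_l)$, $(d_h)$. The product notation is $[a_r;q]_k=(a_1;q)_k(a_2;q)_k\cdots(a_r;q)_k$, with the empty product equal to $1$; similarly for $[b_s;q]_k$, $[c_l;q]_k$, $[d_h;q]_k$. (The parameter $a$ is separate from $a_1,\dots,a_r$, and $c$ is separate from $c_1,\dots,c_l$.) The basic hypergeometric series with $r$ upper and $s$ lower parameters is $${}_r\phi_s\!\left(\begin{matrix}(a_r)\\(b_s)\end{matrix};q;z\right)=\sum_{k=0}^\infty\frac{[a_r;q]_k}{[b_s;q]_k}\left((-1)^kq^{\frac{k(k-1)}{2}}\right)^{1+s-r}\frac{z^k}{(q;q)_k}.$$ All series in the claim terminate, because they have an upper parameter $q^{-N}$ with $N\ge0$ an integer (so that only the terms $0\le k\le N$ contribute); hence they are finite sums. Convention: the parameters and $q$ are such that no denominator vanishes. That is, $(q;q)_n\neq0$; in the inversion formula $[a_r;q]_n\ne0$, $[b_s;q]_n\neq 0$ and $(aq^m;q)_m(aq^{2m+1};q)_{n-m}\ne0$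 for $0\le m\le n$; in the connection formula $[b_s;q]_n$, $[c_l;q]_n$, $[d_h;q]_n$ and $(cq^m;q)_m(cq^{2m+1};q)_{n-m}$ ($0\le m\le n$) are all nonzero. *)

(* Defs.v *)
From HB Require Import structures.
From mathcomp Require Import all_boot all_order all_algebra.
From mathcomp Require Export complex.
From mathcomp Require Import all_classical all_reals all_analysis.

Set Implicit Arguments.
Unset Strict Implicit.
Unset Printing Implicit Defensive.

Import Order.TTheory GRing.Theory Num.Theory numFieldNormedType.Exports.

Local Open Scope ring_scope.
Local Open Scope classical_set_scope.

Definition qpoch (K : fieldType) (x q : K) (n : nat) : K :=
  \prod_(k < n) (1 - x * q ^+ k).

Definition qpochs (K : fieldType) (s : seq K) (q : K) (n : nat) : K :=
  \prod_(y <- s) qpoch y q n.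

Definition qbinom (K : fieldType) (q : K) (n k : nat) : K :=
  qpoch q q n / (qpoch q q k * qpoch q q (n - k)).

(* The exponent 1 + s - r may be negative, hence the integer power.  If the
   series terminates because [q ^ (- N)] is in [A] and if [qpochs B q N] and
   [qpoch q q N] are nonzero, denominators may still vanish at some k > N; the
   numerator vanishes there too, and such terms are 0 since 0 / 0 = 0. *)
Definition qhyp_term (K : fieldType) (A B : seq K) (q z : K) (k : nat) : K :=
  qpochs A q k / qpochs B q k
  * ((-1) ^+ k * q ^+ ((k * k.-1)./2)) ^ (1 + (size B)%:Z - (size A)%:Z)
  * (z ^+ k / qpoch q q k).

Definition qhyp (K : numFieldType) (A B : seq K) (q z : K) : K :=
  limn (series (qhyp_term A B q z)).

Definition qscale (K : fieldType) (s : seq K) (u : K) : seq K :=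
  [seq y * u | y <- s].

(* Main.v *)
Require Import Defs.
From mathcomp Require Import all_boot all_order all_algebra.
From mathcomp Require Import all_classical all_reals all_analysis.
From mathcomp Require Import zify ring.

Set Implicit Arguments.
Unset Strict Implicit.
Unset Printing Implicit Defensive.

Import Order.TTheory GRing.Theory Num.Theory numFieldNormedType.Exports.

Local Open Scope ring_scope.
Local Open Scope complex_scope.

(** Every series here terminates, so it is a polynomial in [x] and the whole
    statement is finite algebra.

    Comparing coefficients of [x ^ k], the inversion formula says that two
    triangular matrices are mutually inverse: the coefficients of the
    polynomials [qhyp [:: q ^- m, a * q ^+ m & A] B q (q * x)], and the
    numbers [invcoef a q n m].  The parameter lists [A] and [B] only rescale
    the coefficient of each [x ^ k] by a factor independent of [m] and drop out
    of the orthogonality relation [invcoef_orthogonal].  In that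
    relation the terms with [m < k] vanish because of the factor
    [(q ^- m; q)_k]; writing [m = k + j] turns the rest, up to a constant, into
    the sum of [invcoef (a * q ^+ (2 * k)) q (n - k) j] over [j]
    ([invcoef_shift]).  That sum has closed partial sums
    ([sum_invcoef_partial]), and it vanishes unless [n = k] ([sum_invcoef]).

    For the connection formula, expand the left side in powers of [x], rewrite
    each [x ^ k] by the inversion formula with parameter [c], upper list [C] and
    lower list [D], and exchange the two summations.  The coefficient of the [m]-th polynomial is
    then a sum over [k >= m]; with [k = m + j] its terms are, one by one, those
    of the series in the statement ([phicoef_connection]). *)

(** * Shifted factorials *)

Section QPochhammer.
Variable K : fieldType.
Implicit Types (x q a b z : K) (A B : seq K) (m n k j : nat).

Lemma qpoch0 x q : qpoch x q 0 = 1.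
Proof. by rewrite /qpoch big_ord0. Qed.

Lemma qpochS x q n : qpoch x q n.+1 = qpoch x q n * (1 - x * q ^+ n).
Proof. by rewrite /qpoch big_ord_recr. Qed.

Lemma qpochD x q m n :
  qpoch x q (m + n) = qpoch x q m * qpoch (x * q ^+ m) q n.
Proof.
rewrite /qpoch big_split_ord; congr (_ * _).
by apply: eq_bigr => i _; rewrite /= -mulrA -exprD.
Qed.

Lemma qpochSl x q n : qpoch x q n.+1 = (1 - x) * qpoch (x * q) q n.
Proof. by rewrite -add1n qpochD expr1 /qpoch big_ord1 expr0 mulr1. Qed.

Lemma qpoch_neq0P x q n :
  reflect (forall i, (i < n)%N -> 1 - x * q ^+ i != 0) (qpoch x q n != 0).
Proof.
rewrite /qpoch; apply: (iffP (prodf_neq0 _ _)) => [H i ltin|H i _].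
  exact: (H (Ordinal ltin)).
exact: H.
Qed.

Lemma qpoch_neq0W x q m n : (m <= n)%N -> qpoch x q n != 0 -> qpoch x q m != 0.
Proof. by move=> /subnKC <-; rewrite qpochD mulf_eq0 negb_or => /andP[]. Qed.

Lemma qpochsD A q m n :
  qpochs A q (m + n) = qpochs A q m * qpochs (qscale A (q ^+ m)) q n.
Proof.
rewrite /qpochs /qscale big_map -big_split.
by apply: eq_bigr => x _; rewrite qpochD.
Qed.

Lemma qpochs_neq0W A q m n :
  (m <= n)%N -> qpochs A q n != 0 -> qpochs A q m != 0.
Proof. by move=> /subnKC <-; rewrite qpochsD mulf_eq0 negb_or => /andP[]. Qed.

Lemma qpochs_cons x A q n : qpochs (x :: A) q n = qpoch x q n * qpochs A q n.
Proof. by rewrite /qpochs big_cons. Qed.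

Lemma qpochs_cat A B q n : qpochs (A ++ B) q n = qpochs A q n * qpochs B q n.
Proof. by rewrite /qpochs big_cat. Qed.

(** The sign and the power of [q] that accompany a reversal of a shifted
    factorial; the powers of [qtri q k] are also the normalizing factors of
    basic hypergeometric series. *)
Definition qtri q n : K := (-1) ^+ n * q ^+ ((n * n.-1)./2).

Lemma qtriD q m n : qtri q (m + n) = qtri q m * qtri q n * q ^+ (m * n).
Proof.
rewrite /qtri -!bin2.
have -> : 'C(m + n, 2) = ('C(m, 2) + 'C(n, 2) + m * n)%N.
  elim: m => [|m IH]; first by rewrite bin0n addn0.
  by rewrite addSn !binS !bin1 IH; lia.
by rewrite !exprD; ring.
Qed.

Lemma qtriS q n : qtri q n.+1 = - qtri q n * q ^+ n.
Proof. by rewrite -addn1 qtriD muln1 /qtri expr0 expr1; ring. Qed.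

Lemma qtri_sqr q n : qtri q n ^+ 2 * q ^+ n = q ^+ (n * n).
Proof.
rewrite /qtri exprMn exprAC sqrrN !expr1n mul1r -exprM muln2 -exprD -bin2.
by congr (q ^+ _); elim: n => [//|n IH]; rewrite binS bin1; lia.
Qed.

Lemma qtri_neq0 q n : q != 0 -> qtri q n != 0.
Proof. by move=> q0; rewrite mulf_neq0 // expf_neq0 // oppr_eq0 oner_eq0. Qed.

(** Each factor [1 - q ^- i] is [- q ^- i * (1 - q ^+ i)], so the left factor is
    a reversed segment of [(q; q)_(d + m)].  Multiplying by [qpoch q q d],
    instead of dividing, makes this hold at roots of unity too. *)
Lemma qpochVX q m d : q != 0 ->
  qpoch (q ^- (d + m)) q m * qpoch q q d
  = qpoch q q (d + m) * qtri q m * q ^- ((d + m) * m).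
Proof.
move=> q0; elim: m => [|m IH].
  by rewrite addn0 muln0 /qtri !expr0 invr1 qpoch0; ring.
have qX k : q ^+ k != 0 by rewrite expf_neq0.
rewrite qpochSl addnS exprS.
rewrite (_ : (q * q ^+ (d + m))^-1 * q = q ^- (d + m)); last first.
  by field; rewrite q0 qX.
rewrite -[LHS]mulrA IH qpochS qtriS.
rewrite (_ : ((d + m).+1 * m.+1 = (d + m) * m + (d + m) + m + 1)%N); last by lia.
rewrite (exprD _ (_ + _ + _) 1) (exprD _ (_ + _) m) (exprD _ (_ * _) (d + m)) expr1.
by field; rewrite !qX q0.
Qed.

Lemma qpochVX_eq0 q m k : q != 0 -> (m < k)%N -> qpoch (q ^- m) q k = 0.
Proof.
move=> q0 mk; apply/eqP; apply: contraT => /qpoch_neq0P/(_ m mk).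
by rewrite mulVf ?subrr ?eqxx // expf_neq0.
Qed.

(** * The inverse coefficients and their orthogonality *)

Definition invcoef a q n m : K :=
  qbinom q n m * (qtri q m / (qpoch (a * q ^+ m) q m
                              * qpoch (a * q ^+ (2 * m + 1)) q (n - m))).

(** The sum telescopes.  Completing the denominator of [invcoef b q N.+1 j] by
    its missing factor [1 - b * q ^+ (2 * j)] gives [(b q ^ j; q)_(N + 2)], and
    the difference of consecutive right sides reduces to
    [(1 - q ^ (N + 1)) * (1 - b * q ^ (2 j)) = q ^ j * (1 - q ^ (N + 1 - j)) *
     (1 - b * q ^ j) + (1 - q ^ j) * (1 - b * q ^ (j + N + 1))].
    The factor [1 - b * q ^+ (2 * j)] may vanish at [j = 0] and [j = N.+1];
    the first case is the base of the induction, and the second is left to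
    [sum_invcoef]. *)
Lemma sum_invcoef_partial b q N J : (J <= N)%N ->
  qpoch q q N.+1 != 0 ->
  (forall i, (0 < i < N.+1.*2)%N -> 1 - b * q ^+ i != 0) ->
  \sum_(0 <= j < J.+1) invcoef b q N.+1 j
  = - qbinom q N J * qtri q J.+1 / qpoch (b * q ^+ J.+1) q N.+1.
Proof.
move=> leJN qN bq; elim: J leJN => [_|J IH ltJN].
  rewrite big_nat1 /invcoef /qbinom /= !subn0 !qpoch0 qtriS /qtri !expr0.
  by rewrite !mul1r !divff ?(qpoch_neq0W _ qN) // !expr1; ring.
rewrite big_nat_recr //= IH ?(ltnW ltJN) //.
have [d defN] : exists d, N = (J + d).+1 by exists (N - J.+1)%N; lia.
set j := J.+1; rewrite /invcoef /qbinom.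
have qpoch_q_neq0 i : (i <= N.+1)%N -> qpoch q q i != 0.
  by move=> leiN; exact: qpoch_neq0W leiN qN.
have qi_neq0 i : (i <= N)%N -> 1 - q * q ^+ i != 0.
  by move=> leiN; move/qpoch_neq0P: qN; apply.
have -> : (N - J = d.+1)%N by lia.
have -> : (N - j = d)%N by lia.
have -> : (N.+1 - j = d.+1)%N by lia.
have nz1 := bq j ltac:(lia).
have nz2 := bq (2 * j)%N ltac:(lia).
have nz3 := bq (j + N.+1)%N ltac:(lia).
have nzD : qpoch (b * q ^+ j.+1) q N != 0.
  by apply/qpoch_neq0P => i ltiN; rewrite -mulrA -exprD bq //; lia.
set D := qpoch (b * q ^+ j.+1) q N in nzD *.
have E1 : qpoch (b * q ^+ j) q N.+1 = (1 - b * q ^+ j) * D.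
  by rewrite qpochSl -mulrA -exprSr.
have E2 : qpoch (b * q ^+ j.+1) q N.+1 = D * (1 - b * q ^+ (j + N.+1)).
  by rewrite qpochS -mulrA -exprD addnS addSn.
(* The two factors are [(b q ^ j; q)_(N + 2)] with one factor left out. *)
have E3 : qpoch (b * q ^+ j) q j * qpoch (b * q ^+ (2 * j + 1)) q d.+1
   = (1 - b * q ^+ j) * D * (1 - b * q ^+ (j + N.+1)) / (1 - b * q ^+ (2 * j)).
  apply: (canRL (mulfK nz2)); rewrite -mulrA [_ * (1 - _)]mulrC mulrA.
  rewrite mul2n -addnn exprD mulrA -qpochS addn1 exprSr.
  rewrite (_ : b * (q ^+ (j + j) * q) = b * q ^+ j * q ^+ j.+1); last first.
    by rewrite -mulrA -exprD -exprSr addnS.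
  rewrite -qpochD addSn -addnS (_ : (j + d.+2 = N.+2)%N); last lia.
  by rewrite qpochSl -mulrA -exprSr -/D E2 mulrA -mulrA.
rewrite E1 E2 E3 !qtriS /j !qpochS.
have := qpoch_q_neq0 J ltac:(lia); have := qpoch_q_neq0 d ltac:(lia).
have := qpoch_q_neq0 N ltac:(lia).
have := qi_neq0 J ltac:(lia); have := qi_neq0 d ltac:(lia).
have := qi_neq0 N ltac:(lia).
move: nz1 nz2 nz3 nzD; rewrite /j.
rewrite (_ : (2 * J.+1 = J + J + 2)%N); last lia.
rewrite (_ : (J.+1 + N.+1 = J + J + d + 3)%N); last lia.
rewrite defN !(exprD, exprS) !expr0 !mulr1.
move: (q ^+ J) (q ^+ d) (qpoch q q J) (qpoch q q d) (qpoch q q (J + d).+1).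
move=> X Y PJ Pd PN nz1 nz2 nz3 nzD' nz4 nz5 nz6 nz7 nz8 nz9.
move: D nzD' {E1 E2 E3} => D nzD.
by field; rewrite nz1 nz2 nz3 nz5 nz6 nz8 nz9 nzD.
Qed.

Lemma sum_invcoef b q N : qpoch q q N != 0 ->
  (forall i, (0 < i < N.*2)%N -> 1 - b * q ^+ i != 0) ->
  \sum_(0 <= j < N.+1) invcoef b q N j = (N == 0%N)%:R.
Proof.
case: N => [|N] qN bq.
  rewrite big_nat1 /invcoef /qbinom /= !qpoch0 /qtri !expr0.
  by rewrite !mul1r !invr1 !mulr1.
rewrite big_nat_recr //= sum_invcoef_partial // /invcoef /qbinom !subnn !qpoch0.
have nzN := qpoch_neq0W (leqnSn N) qN.
have nzb : qpoch (b * q ^+ N.+1) q N.+1 != 0.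
  by apply/qpoch_neq0P => i ltiN; rewrite -mulrA -exprD bq //; lia.
by field; rewrite nzN nzb qN.
Qed.

(** Substituting [m = k + j] in a term of the orthogonality relation of length
    [n = k + j + d] leaves an inverse coefficient with [a] replaced by
    [a * q ^+ (2 * k)]: the factorial [(a q ^ m; q)_k] cancels the first [k]
    factors of [(a q ^ m; q)_m], and the powers of [q] depending on [j]
    cancel out. *)
Lemma invcoef_shift a q k j d : q != 0 ->
  qpoch q q (k + j + d) != 0 -> qpoch (a * q ^+ (k + j)) q k != 0 ->
  invcoef a q (k + j + d) (k + j)
    * (qpoch (q ^- (k + j)) q k * qpoch (a * q ^+ (k + j)) q k)
  = qpoch q q (k + j + d) / (qpoch q q (j + d) * q ^+ k)
    * invcoef (a * q ^+ (k * 2)) q (j + d) j.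
Proof.
move=> q0 qn akj.
have qX i : q ^+ i != 0 by rewrite expf_neq0.
have nzj : qpoch q q j != 0 by apply: qpoch_neq0W qn; lia.
have nzd : qpoch q q d != 0 by apply: qpoch_neq0W qn; lia.
have nzkj : qpoch q q (k + j) != 0 by apply: qpoch_neq0W qn; lia.
have nzjd : qpoch q q (j + d) != 0 by apply: qpoch_neq0W qn; lia.
have E1 : qpoch (q ^- (k + j)) q k
    = qpoch q q (k + j) / qpoch q q j * qtri q k * q ^- (k * j) * q ^- (k * k).
  apply: (mulIf nzj); rewrite [(k + j)%N]addnC qpochVX // mulnDl exprD [(j * k)%N]mulnC.
  by field; rewrite !qX nzj.
have E2 : q ^+ (k * k) = qtri q k ^+ 2 * q ^+ k by rewrite qtri_sqr.
rewrite /invcoef /qbinom [(k + j + d - _)%N]addKn [(j + d - j)%N]addKn.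
rewrite (qpochD (a * _) q k j) qtriD !invfM E1 E2.
have -> : a * q ^+ (k + j) * q ^+ k = a * q ^+ (k * 2) * q ^+ j.
  by rewrite -!mulrA -!exprD; congr (_ * q ^+ _); lia.
have -> : a * q ^+ (2 * (k + j) + 1) = a * q ^+ (k * 2) * q ^+ (2 * j + 1).
  by rewrite -!mulrA -!exprD; congr (_ * q ^+ _); lia.
move: (qpoch (_ * q ^+ (2 * j + 1)) q d)^-1 => U.
move: (qpoch (_ * q ^+ j) q j)^-1 => V.
have nzk := qtri_neq0 k q0.
by field; rewrite !qX nzk akj nzj nzd nzkj nzjd.
Qed.

(** The index [m = 0] covers the exponents [1, ..., n], and [m = n] covers
    [n, ..., 2 n - 1]. The values [a = 1] and [a * q ^+ (2 * n) = 1] remain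
    possible. *)
Lemma invcoef_neq1 a q n :
  (forall m, (m <= n)%N ->
     qpoch (a * q ^+ m) q m * qpoch (a * q ^+ (2 * m + 1)) q (n - m) != 0) ->
  forall i, (0 < i < n.*2)%N -> 1 - a * q ^+ i != 0.
Proof.
move=> an i /andP[i0 i2n]; case: (leqP i n) => [lein|ltni].
  have := an 0%N isT; rewrite mulf_eq0 negb_or => /andP[_ /qpoch_neq0P].
  by move=> /(_ i.-1 ltac:(lia)); rewrite -mulrA -exprD (_ : (_ + i.-1 = i)%N); last lia.
have := an n (leqnn n); rewrite mulf_eq0 negb_or => /andP[/qpoch_neq0P].
move=> /(_ (i - n)%N ltac:(lia)) + _.
by rewrite -mulrA -exprD subnKC // ltnW.
Qed.

Lemma invcoef_orthogonal a q n k : q != 0 -> qpoch q q n != 0 ->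
  (forall i, (0 < i < n.*2)%N -> 1 - a * q ^+ i != 0) -> (k <= n)%N ->
  \sum_(0 <= m < n.+1) invcoef a q n m
     * (qpoch (q ^- m) q k * qpoch (a * q ^+ m) q k)
  = (k == n)%:R * (qpoch q q n / q ^+ n).
Proof.
move=> q0 qn an lekn.
rewrite (big_cat_nat (n := k)) ?leqW //= big_nat_cond big1 ?add0r; last first.
  by move=> m /andP[/andP[_ ltmk] _]; rewrite qpochVX_eq0 // mul0r mulr0.
have [N defn] : exists N, n = (k + N)%N by exists (n - k)%N; rewrite subnKC.
rewrite -[X in index_iota X _]add0n big_addn (_ : (n.+1 - k = N.+1)%N); last by lia.
transitivity (\sum_(0 <= j < N.+1) qpoch q q n / (qpoch q q N * q ^+ k)
    * invcoef (a * q ^+ (k * 2)) q N j).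
  apply: eq_big_nat => j /andP[_ ltjN].
  have -> : n = (k + j + (N - j))%N by lia.
  rewrite [(j + k)%N]addnC invcoef_shift //.
  - by rewrite [(j + _)%N]subnKC.
  - by rewrite (_ : (k + j + (N - j))%N = n) //; lia.
  apply/qpoch_neq0P => i ltik; rewrite -mulrA -exprD; apply: an.
  by lia.
rewrite -big_distrr /= sum_invcoef.
- rewrite defn (_ : (k == _) = (N == 0%N)); last by lia.
  case: N {defn} => [|N]; last by rewrite mulr0 mul0r.
  by rewrite addn0 qpoch0 mul1r mulr1 mul1r.
- by apply: qpoch_neq0W qn; lia.
- by move=> i ltiN; rewrite -mulrA -exprD; apply: an; lia.
Qed.

(** * Expansion in powers of the variable *)

(** The part of the [k]-th coefficient of a series with upper parameters
    [u, v & A] that does not depend on [u] and [v]; the argument [q * x] of the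
    series contributes [q ^+ k]. *)
Definition phicoef A B q k : K :=
  qpochs A q k / qpochs B q k
  * qtri q k ^ ((size B)%:Z - (size A)%:Z - 1) * (q ^+ k / qpoch q q k).

Lemma qhyp_term_cons2 A B q u v x k :
  qhyp_term [:: u, v & A] B q (q * x) k
  = phicoef A B q k * (qpoch u q k * qpoch v q k) * x ^+ k.
Proof.
rewrite /qhyp_term /phicoef !qpochs_cons -/(qtri q k) exprMn /=.
rewrite (_ : 1 + _ - _ = (size B)%:Z - (size A)%:Z - 1 :> int); last by lia.
by ring.
Qed.

(** The term-by-term content of the connection formula.  On the left is the
    coefficient of [x ^ (m + j)] in the series to be expanded, times the
    coefficient of the [m]-th polynomial in the inversion formula for
    [x ^ (m + j)].  Every factorial splits as [(y; q)_m * (y q ^ m; q)_j], and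
    the two integer powers of [qtri q (m + j)] combine into the exponent [e];
    the cross term [q ^ (m * j)] of [qtriD] produces the argument
    [q ^ (1 + m * e)]. *)
Lemma phicoef_connection A B C D q a c m j d :
  let n := (m + j + d)%N in
  let e : int := (size B)%:Z + (size C)%:Z - (size A)%:Z - (size D)%:Z in
  q != 0 -> qpoch q q n != 0 ->
  phicoef A B q (m + j) * (qpoch (q ^- n) q (m + j) * qpoch (a * q ^+ n) q (m + j))
  * (qpochs D q (m + j) / qpochs C q (m + j)
     * qtri q (m + j) ^ ((size C)%:Z + 1 - (size D)%:Z) * invcoef c q (m + j) m)
  = qbinom q n m
    * (-1) ^ (m%:Z * e)
    * (qpoch (a * q ^+ n) q m / qpoch (c * q ^+ m) q m)
    * (qpochs A q m / qpochs B q m)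
    * (qpochs D q m / qpochs C q m)
    * q ^ (((m * m.-1)./2)%:Z * e)
    * q ^ (m%:Z * (m%:Z - n%:Z))
    * qhyp_term [:: q ^ (m%:Z - n%:Z), a * q ^+ (m + n)
                  & qscale A (q ^+ m) ++ qscale D (q ^+ m)]
                (c * q ^+ (2 * m + 1)
                   :: qscale B (q ^+ m) ++ qscale C (q ^+ m))
                q (q ^ (1 + m%:Z * e)) j.
Proof.
move=> n e q0 qn.
have qX i : q ^+ i != 0 by rewrite expf_neq0.
have nztri := qtri_neq0 _ q0.
have nzj : qpoch q q j != 0 by apply: qpoch_neq0W qn; lia.
have nzm : qpoch q q m != 0 by apply: qpoch_neq0W qn; lia.
have nzmj : qpoch q q (m + j) != 0 by apply: qpoch_neq0W qn; lia.
have nzjd : qpoch q q (j + d) != 0 by apply: qpoch_neq0W qn; lia.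
rewrite /qhyp_term !qpochs_cons !qpochs_cat -/(qtri q j) /=.
rewrite !size_cat !size_map.
have -> : 1 + (size B + size C).+1%:Z - (size A + size D).+2%:Z = e.
  by rewrite /e; lia.
have -> : m%:Z - n%:Z = - (j + d)%N%:Z by rewrite /n -addnA PoszD opprD addrA subrr add0r.
have -> : m%:Z * - (j + d)%N%:Z = - (m * (j + d))%N%:Z by rewrite mulrN.
rewrite -!exprnN.
have Eqm : (-1) ^ (m%:Z * e) * q ^ (((m * m.-1)./2)%:Z * e) = qtri q m ^ e.
  by rewrite -!exprz_exp -expfzMl.
have Ez : (q ^ (1 + m%:Z * e)) ^+ j = q ^+ j * (q ^+ (m * j)) ^ e.
  rewrite expfzDr // expr1z exprMn; congr (_ * _).
  by rewrite !exprnP !exprz_exp PoszM mulrAC.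
have Ee : qtri q (m + j) ^ ((size B)%:Z - (size A)%:Z - 1)
     * qtri q (m + j) ^ ((size C)%:Z + 1 - (size D)%:Z)
   = qtri q m ^ e * qtri q j ^ e * (q ^+ (m * j)) ^ e.
  rewrite -expfzDr // -!expfzMl -qtriD; congr (_ ^ _); rewrite /e; lia.
have Em : qpoch (q ^- n) q m
    = qpoch q q n / qpoch q q (j + d) * qtri q m / q ^+ (m * m) / q ^+ (m * (j + d)).
  apply: (mulIf nzjd); rewrite /n -addnA [(m + (j + d))%N]addnC qpochVX //.
  rewrite [in LHS]mulnDl exprD [((j + d) * m)%N]mulnC.
  by field; rewrite !qX nzjd.
have Emm : q ^+ (m * m) = qtri q m ^+ 2 * q ^+ m by rewrite qtri_sqr.
have En : q ^- n * q ^+ m = q ^- (j + d).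
  by rewrite /n -addnA exprD; field; rewrite !qX.
have Ean : a * q ^+ n * q ^+ m = a * q ^+ (m + n) by rewrite -mulrA -exprD addnC.
rewrite /phicoef /invcoef /qbinom !qpochsD (qpochD (q ^- n)) (qpochD (a * _)).
rewrite Em En Ean Ez exprD addKn [(n - m)%N](_ : _ = j + d)%N; last first.
  by rewrite /n -addnA addKn.
rewrite !invfM Emm.
have nzS i (t : int) : qtri q i ^ t != 0 by rewrite expfz_neq0.
have nz1 : (-1) ^ (m%:Z * e) != 0 :> K by rewrite expfz_neq0 // oppr_eq0 oner_eq0.
rewrite (canRL (mulKf (nzS _ _)) Ee) (canRL (mulKf nz1) Eqm).
(* The same reciprocals occur on both sides: treating them as unknowns spares
   [field] the corresponding side conditions. *)
move: (qpochs (qscale C _) q j)^-1 (qpochs (qscale B _) q j)^-1.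
move: (qpoch (c * q ^+ (2 * m + 1)) q j)^-1 (qpoch (c * q ^+ m) q m)^-1.
move: (qpochs C q m)^-1 (qpochs B q m)^-1 => iC iB icm icj iBj iCj.
move: (nzS (m + j)%N ((size B)%:Z - (size A)%:Z - 1)) nz1 (nztri m) (nztri j).
move: (qX m) (qX (m * (j + d))%N) nzj nzm nzmj nzjd.
move: (qtri q m ^ e) (qtri q j ^ e) (_ ^ ((size B)%:Z - _ - 1)) (_ ^ (m%:Z * e)).
move: (q ^+ (m * j) ^ e) (qtri q m) (qtri q j) (q ^+ (m * _)) (q ^+ m).
move: (qpoch q q m) (qpoch q q j) (qpoch q q n) (qpoch q q (m + j)) (qpoch q q (j + d)).
move=> pm pj pn pmj pjd X Y tj tm W se1 u sje sme.
move=> X0 Y0 pj0 pm0 pmj0 pjd0 u0 se10 tm0 tj0.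
by field; rewrite X0 Y0 pj0 pm0 pmj0 pjd0 u0 se10 tm0.
Qed.

End QPochhammer.

(** * Inversion and connection formulas *)

Section TerminatingSeries.
Variable K : numFieldType.
Implicit Types (q a c x z : K) (A B C D : seq K) (m n k : nat).

Lemma qhyp_terminating A B q z n :
  (forall k, (n < k)%N -> qpochs A q k = 0) ->
  qhyp A B q z = \sum_(0 <= k < n.+1) qhyp_term A B q z k.
Proof.
move=> A0; apply: (@norm_lim_near_cst K K).
exists n.+1 => // k /= ltnk.
rewrite /series /= (big_cat_nat (n := n.+1)) //= [X in _ + X]big_nat_cond.
rewrite [X in _ + X]big1 ?addr0 // => i /andP[/andP[lti _] _].
by rewrite /qhyp_term A0 // !mul0r.
Qed.

(** The summation bound is any [n >= m], so that polynomials of different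
    degrees [m] can be summed coefficientwise. *)
Lemma qhyp_polynomial A B q u x m n : q != 0 -> (m <= n)%N ->
  qhyp [:: q ^- m, u & A] B q (q * x)
  = \sum_(0 <= k < n.+1)
       phicoef A B q k * (qpoch (q ^- m) q k * qpoch u q k) * x ^+ k.
Proof.
move=> q0 lemn; rewrite (@qhyp_terminating _ _ _ _ n) => [|k ltnk].
  by apply: eq_bigr => k _; rewrite qhyp_term_cons2.
by rewrite qpochs_cons qpochVX_eq0 ?mul0r // (leq_ltn_trans lemn).
Qed.

(** After exchanging the sums, [invcoef_orthogonal] kills every power of [x] but
    [x ^ n], whose coefficient is the reciprocal of the prefactor. *)
Lemma qhyp_inversion A B q a n : q != 0 -> qpoch q q n != 0 ->
  qpochs A q n != 0 -> qpochs B q n != 0 ->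
  (forall i, (0 < i < n.*2)%N -> 1 - a * q ^+ i != 0) ->
  forall x, x ^+ n =
    qpochs B q n / qpochs A q n * qtri q n ^ ((size A)%:Z + 1 - (size B)%:Z)
    * \sum_(0 <= m < n.+1) invcoef a q n m
        * qhyp [:: q ^- m, a * q ^+ m & A] B q (q * x).
Proof.
move=> q0 qn An Bn an x.
have -> : \sum_(0 <= m < n.+1) invcoef a q n m
        * qhyp [:: q ^- m, a * q ^+ m & A] B q (q * x)
  = \sum_(0 <= k < n.+1) phicoef A B q k * x ^+ k
      * ((k == n)%:R * (qpoch q q n / q ^+ n)).
  under eq_big_nat => m ltmn do rewrite (@qhyp_polynomial A B q _ x m n q0 ltmn) big_distrr.
  rewrite exchange_big_nat /=; apply: eq_big_nat => k /andP[_ lekn].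
  rewrite -(invcoef_orthogonal q0 qn an lekn) big_distrr /=.
  by apply: eq_bigr => m _; ring.
rewrite big_nat_recr //= big_nat big1 ?add0r => [|k /andP[_ ltkn]]; last first.
  by rewrite ltn_eqF // mul0r mulr0.
rewrite eqxx mul1r /phicoef.
have qX i : q ^+ i != 0 by rewrite expf_neq0.
have -> : (size A)%:Z + 1 - (size B)%:Z = - ((size B)%:Z - (size A)%:Z - 1) by lia.
rewrite -invr_expz.
have := expfz_neq0 ((size B)%:Z - (size A)%:Z - 1) (qtri_neq0 n q0).
by move: (qtri q n ^ _) => t t0; field; rewrite t0 !qX qn An Bn.
Qed.

Lemma qhyp_connection A B C D q a c n : q != 0 -> qpoch q q n != 0 ->
  qpochs C q n != 0 -> qpochs D q n != 0 ->
  (forall i, (0 < i < n.*2)%N -> 1 - c * q ^+ i != 0) ->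
  forall x,
  let e : int := (size B)%:Z + (size C)%:Z - (size A)%:Z - (size D)%:Z in
  qhyp [:: q ^- n, a * q ^+ n & A] B q (q * x) =
  \sum_(0 <= m < n.+1)
    qbinom q n m
    * (-1) ^ (m%:Z * e)
    * (qpoch (a * q ^+ n) q m / qpoch (c * q ^+ m) q m)
    * (qpochs A q m / qpochs B q m)
    * (qpochs D q m / qpochs C q m)
    * q ^ (((m * m.-1)./2)%:Z * e)
    * q ^ (m%:Z * (m%:Z - n%:Z))
    * qhyp [:: q ^ (m%:Z - n%:Z), a * q ^+ (m + n)
             & qscale A (q ^+ m) ++ qscale D (q ^+ m)]
           (c * q ^+ (2 * m + 1)
              :: qscale B (q ^+ m) ++ qscale C (q ^+ m))
           q (q ^ (1 + m%:Z * e))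
    * qhyp [:: q ^- m, c * q ^+ m & C] D q (q * x).
Proof.
move=> q0 qn Cn Dn cn x e.
rewrite (qhyp_polynomial _ _ _ _ q0 (leqnn n)).
pose F k m := phicoef A B q k * (qpoch (q ^- n) q k * qpoch (a * q ^+ n) q k)
  * (qpochs D q k / qpochs C q k
     * qtri q k ^ ((size C)%:Z + 1 - (size D)%:Z) * invcoef c q k m)
  * qhyp [:: q ^- m, c * q ^+ m & C] D q (q * x).
transitivity (\sum_(0 <= k < n.+1) \sum_(0 <= m < n.+1 | (m <= k)%N) F k m).
  apply: eq_big_nat => k /andP[_ lekn].
  rewrite (@qhyp_inversion C D q c k) //; first last.
  - by move=> i ltik; apply: cn; lia.
  - exact: qpochs_neq0W Dn.
  - exact: qpochs_neq0W Cn.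
  - exact: qpoch_neq0W qn.
  rewrite -(@big_nat_widen _ _ _ 0 k.+1 n.+1 xpredT) // !big_distrr /=.
  by apply: eq_bigr => m _; rewrite /F; ring.
(* For fixed [m], what remains is the sum over [k] from [m] to [n]. *)
rewrite (exchange_big_dep_nat xpredT) //=.
apply: eq_big_nat => m /andP[_ lemn].
rewrite -(@big_nat_widenl _ _ _ m 0 n.+1 xpredT) //.
have [N defn] : exists N, n = (m + N)%N by exists (n - m)%N; rewrite subnKC.
rewrite (@qhyp_terminating _ _ _ _ N) => [|k ltNk]; last first.
  rewrite qpochs_cons (_ : m%:Z - n%:Z = - N%:Z); last by rewrite defn; lia.
  by rewrite -exprnN qpochVX_eq0 // mul0r.
rewrite big_distrr big_distrl /= -[X in index_iota X _]add0n big_addn.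
rewrite (_ : (n.+1 - m = N.+1)%N); last by lia.
apply: eq_big_nat => j /andP[_ ltjN].
have defn' : n = (m + j + (N - j))%N by lia.
rewrite /F [(j + m)%N]addnC; congr (_ * _).
by rewrite {}defn' in qn *; rewrite phicoef_connection.
Qed.

End TerminatingSeries.

Theorem theorem2p1 (R : realType) (r s l h : nat) (q a c : R[i])
    (ar : r.-tuple R[i]) (bs : s.-tuple R[i])
    (cl : l.-tuple R[i]) (dh : h.-tuple R[i])
    (n : nat) (q_neq0 : q != 0) (qn_neq0 : qpoch q q n != 0) :
  (* inversion formula *)
  (qpochs ar q n != 0 ->
   qpochs bs q n != 0 ->
   (forall m : nat, (m <= n)%N ->
      qpoch (a * q ^+ m) q m * qpoch (a * q ^+ (2 * m + 1)) q (n - m) != 0) ->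
   forall x : R[i],
     x ^+ n =
       qpochs bs q n / qpochs ar q n
       * ((-1) ^+ n * q ^+ ((n * n.-1)./2)) ^ (r%:Z + 1 - s%:Z)
       * \sum_(0 <= m < n.+1)
           qbinom q n m
           * ((-1) ^+ m * q ^+ ((m * m.-1)./2)
              / (qpoch (a * q ^+ m) q m
                 * qpoch (a * q ^+ (2 * m + 1)) q (n - m)))
           * qhyp [:: q ^- m, a * q ^+ m & ar] bs q (q * x))
  /\
  (* connection formula *)
  (qpochs bs q n != 0 ->
   qpochs cl q n != 0 ->
   qpochs dh q n != 0 ->
   (forall m : nat, (m <= n)%N ->
      qpoch (c * q ^+ m) q m * qpoch (c * q ^+ (2 * m + 1)) q (n - m) != 0) ->
   forall x : R[i],
     let e : int := s%:Z + l%:Z - r%:Z - h%:Z in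
     qhyp [:: q ^- n, a * q ^+ n & ar] bs q (q * x) =
       \sum_(0 <= m < n.+1)
         qbinom q n m
         * (-1) ^ (m%:Z * e)
         * (qpoch (a * q ^+ n) q m / qpoch (c * q ^+ m) q m)
         * (qpochs ar q m / qpochs bs q m)
         * (qpochs dh q m / qpochs cl q m)
         * q ^ (((m * m.-1)./2)%:Z * e)
         * q ^ (m%:Z * (m%:Z - n%:Z))
         * qhyp [:: q ^ (m%:Z - n%:Z), a * q ^+ (m + n)
                  & qscale ar (q ^+ m) ++ qscale dh (q ^+ m)]
                (c * q ^+ (2 * m + 1)
                   :: qscale bs (q ^+ m) ++ qscale cl (q ^+ m))
                q (q ^ (1 + m%:Z * e))
         * qhyp [:: q ^- m, c * q ^+ m & cl] dh q (q * x)).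
Proof.
split=> [An Bn an x|Bn Cn Dn cn x e].
  rewrite (@qhyp_inversion _ ar bs q a n) ?size_tuple //.
  exact: invcoef_neq1 an.
have := @qhyp_connection _ ar bs cl dh q a c n q_neq0 qn_neq0 Cn Dn.
by move=> /(_ (invcoef_neq1 cn) x); rewrite !size_tuple; apply.
Qed.
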